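(* Let $a_1,a_2>0$, $\beta=a_1+a_2$, $0<p<q$, $0<\ell<u<+\infty$, and $f:\mathbb{R}_+^2\to\mathbb{R}_+$, $f(x)=x_1^{a_1}x_2^{a_2}$. Let $X=\{x\in\mathbb{R}_+^2:\ell\le f(x)\le u\}$, $W_{12}=\{x\in\mathbb{R}^2_+: p x_1\le x_2\le q x_1\}$ and $F(W_{12})=\{(x,z)\in (X\cap W_{12})\times\mathbb{R}: z=f(x)\}$. Let $z_0,\gamma,\lambda,\zeta,d_1,d_2$ and $Y$ be as defined in the context. If $\beta\ge 1$, then $$\mathrm{conv}(F(W_{12}))=\{(x,z)\in Y\times\mathbb{R}:\ \max\{\ell,\lambda(d_2x_1-d_1x_2)^\beta\}\le z\le\min\{u,\ z_0+(\gamma x_1^{a_1}x_2^{a_2})^{1/\beta}\}\}.$$ If $\beta\le 1$, then $$\mathrm{conv}(F(W_{12}))=\{(x,z)\in Y\times\mathbb{R}:\ \max\{\ell,\zeta(d_2x_1-d_1x_2)+z_0\}\le z\le\min\{u,\ x_1^{a_1}x_2^{a_2}\}\}.$$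
   Context: $\mathbb{R}_+$ denotes the nonnegative reals and $\mathrm{conv}$ the convex hull. Constants: $d_1=q^{-a_2/(a_1+a_2)}-p^{-a_2/(a_1+a_2)}$, $d_2=q^{a_1/(a_1+a_2)}-p^{a_1/(a_1+a_2)}$, $\lambda=\dfrac{p^{a_2}}{(d_2-d_1p)^{a_1+a_2}}$, $z_0=\dfrac{u^{1/\beta}\ell-\ell^{1/\beta}u}{u^{1/\beta}-\ell^{1/\beta}}$, $\gamma=\left(\dfrac{u-\ell}{u^{1/\beta}-\ell^{1/\beta}}\right)^{\beta}$, $\zeta=\lambda^{1/\beta}\dfrac{u-\ell}{u^{1/\beta}-\ell^{1/\beta}}$. Set: $Y=\{x\in\mathbb{R}_+^2:\ p x_1\le x_2\le q x_1,\ x_1^{a_1}x_2^{a_2}\ge \ell,\ d_2x_1-d_1x_2\le (u/\lambda)^{1/\beta}\}$. *)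

(* Defs.v *)
From HB Require Import structures.
From mathcomp Require Import all_boot all_order all_algebra.
From mathcomp Require Import all_classical all_reals all_analysis.

Set Implicit Arguments.
Unset Strict Implicit.
Unset Printing Implicit Defensive.

Import Order.TTheory GRing.Theory Num.Theory.
Import numFieldNormedType.Exports.

Local Open Scope classical_set_scope.
Local Open Scope ring_scope.

Definition conv_hull (R : numDomainType) (M : lmodType R) (A : set M) : set M :=
  smallest (@convex_set R M) A.

Section constants.
Variable R : realType.
Implicit Types beta p q l u : R.

Definition d1 (a1 a2 : R) p q : R :=
  q `^ (- a2 / (a1 + a2)) - p `^ (- a2 / (a1 + a2)).

Definition d2 (a1 a2 : R) p q : R :=
  q `^ (a1 / (a1 + a2)) - p `^ (a1 / (a1 + a2)).

Definition lambda (a1 a2 : R) p q : R :=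
  p `^ a2 / (d2 a1 a2 p q - d1 a1 a2 p q * p) `^ (a1 + a2).

Definition z0 beta l u : R :=
  (u `^ beta^-1 * l - l `^ beta^-1 * u) / (u `^ beta^-1 - l `^ beta^-1).

Definition gamma beta l u : R :=
  ((u - l) / (u `^ beta^-1 - l `^ beta^-1)) `^ beta.

Definition zeta (a1 a2 : R) p q l u : R :=
  lambda a1 a2 p q `^ (a1 + a2)^-1 *
  ((u - l) / (u `^ (a1 + a2)^-1 - l `^ (a1 + a2)^-1)).

End constants.

(* The plane is [R^o * R^o]: [R^o] is [R] as a module over itself, so that the
   product carries the module structure needed to speak of convexity. *)
Section sets.
Variable R : realType.
Implicit Types (p q l u : R) (x : R^o * R^o).

Definition nonneg_quadrant : set (R^o * R^o) := [set x | 0 <= x.1 /\ 0 <= x.2].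

(* Only meaningful on [nonneg_quadrant]; there [0 `^ a = 0] since [a > 0]. *)
Definition f (a1 a2 : R) x : R := x.1 `^ a1 * x.2 `^ a2.

Definition X (a1 a2 : R) l u : set (R^o * R^o) :=
  [set x | nonneg_quadrant x /\ l <= f a1 a2 x <= u].

Definition W12 p q : set (R^o * R^o) :=
  [set x | nonneg_quadrant x /\ p * x.1 <= x.2 <= q * x.1].

Definition F (a1 a2 : R) l u (W : set (R^o * R^o)) : set (R^o * R^o * R^o) :=
  [set xz : R^o * R^o * R^o | (X a1 a2 l u `&` W) xz.1 /\ xz.2 = f a1 a2 xz.1].

Definition Y (a1 a2 : R) p q l u : set (R^o * R^o) :=
  [set x | [/\ nonneg_quadrant x,
               p * x.1 <= x.2 <= q * x.1,
               l <= x.1 `^ a1 * x.2 `^ a2 &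
               d2 a1 a2 p q * x.1 - d1 a1 a2 p q * x.2
                 <= (u / lambda a1 a2 p q) `^ (a1 + a2)^-1]].

End sets.

(* Main.v *)
Require Import Defs.
From HB Require Import structures.
From mathcomp Require Import all_boot all_order all_algebra.
From mathcomp Require Import all_classical all_reals all_analysis.
From mathcomp Require Import ring lra.
Set Implicit Arguments.
Unset Strict Implicit.
Unset Printing Implicit Defensive.
Import Order.TTheory GRing.Theory Num.Theory.
Import numFieldNormedType.Exports.
Local Open Scope classical_set_scope.
Local Open Scope ring_scope.

(* Put beta = a1 + a2, s = a1 / beta, t = a2 / beta. Then f = geom ^ beta, where
   geom x = x1^s x2^t is concave and homogeneous of degree 1, and
   lambda^(1/beta) (d2 x1 - d1 x2) is the linear function [secant] that agrees
   with geom on the two rays bounding W12, so secant <= geom on W12.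
   The right-hand sides are convex and contain the graph because r -> r^beta
   lies on the appropriate side of its chord over [l^(1/beta), u^(1/beta)].
   Conversely it suffices to reach the lowest and highest point over each x.
   If secant x <= c <= geom x, then x lies between two points of W12 where
   geom = c, which puts (x, c^beta) in the hull; the extreme points not of this
   form lie on the chord, and are reached by scaling x, or the two points of
   the bounding rays with the same value of secant as x, up to the level u and
   down to the level l. The only properties of r -> r^beta that matter are
   monotonicity and convexity (or concavity). *)

(** * Convex sets and convex hulls *)

Section Hull.
Context {R : realType} {M : lmodType R}.
Implicit Types (A B : set M).

Lemma convex_setP (A : set M) :
  convex_set A <-> forall t x y, 0 <= t <= 1 -> A x -> A y ->
    A (t *: x + (1 - t) *: y).
Proof.
split=> [cA t x y /andP[t0 t1] Ax Ay|cA x y t /set_mem Ax /set_mem Ay].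
  have := cA x y (Itv01 t0 t1) (mem_set Ax) (mem_set Ay).
  by move=> /set_mem.
by apply/mem_set; apply: cA => //; apply/andP; split.
Qed.

Lemma conv_hull_eq (A B : set M) : convex_set B -> A `<=` B ->
  (forall C : set M, convex_set C -> A `<=` C -> B `<=` C) ->
  conv_hull A = B.
Proof.
move=> cB AB minB; apply/seteqP; split; first exact: smallest_sub.
by move=> x Bx C [cC AC]; exact: minB Bx.
Qed.

End Hull.

(** * Real powers: convexity, roots, weighted AM-GM *)

Section Power.
Context {R : realType}.
Implicit Types (b s t w x y : R).

Lemma powR_convex b w x y : 1 <= b -> 0 <= w <= 1 -> 0 <= x -> 0 <= y ->
  (w * x + (1 - w) * y) `^ b <= w * x `^ b + (1 - w) * y `^ b.
Proof.
move=> b1 /andP[w0 w1] x0 y0.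
have := @convex_powR R b b1 (Itv01 w0 w1) x y.
by rewrite !inE/= !in_itv/= !andbT !convRE/=; apply.
Qed.

Lemma powR_invK b x : b != 0 -> 0 <= x -> (x `^ b^-1) `^ b = x.
Proof. by move=> b0 x0; rewrite -powRrM mulVf// powRr1. Qed.

Lemma powR_Kinv b x : b != 0 -> 0 <= x -> (x `^ b) `^ b^-1 = x.
Proof. by move=> b0 x0; rewrite -powRrM mulfV// powRr1. Qed.

(** The exponent [b^-1] is at least 1, so its power function is convex; apply this to [x^b] and
    [y^b] and raise the result to the power [b]. *)
Lemma powR_concave b w x y : 0 < b -> b <= 1 -> 0 <= w <= 1 ->
  0 <= x -> 0 <= y ->
  w * x `^ b + (1 - w) * y `^ b <= (w * x + (1 - w) * y) `^ b.
Proof.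
move=> b0 b1 w01 x0 y0; have /andP[w0 w1] := w01.
have bn0 : b != 0 by rewrite gt_eqF.
have w'0 : 0 <= 1 - w by rewrite subr_ge0.
have bV1 : 1 <= b^-1 by rewrite invf_ge1.
have := powR_convex bV1 w01 (powR_ge0 x b) (powR_ge0 y b).
rewrite !powR_Kinv// => h.
have s0 : 0 <= w * x `^ b + (1 - w) * y `^ b.
  by rewrite addr_ge0// mulr_ge0// powR_ge0.
rewrite -[leLHS](powR_invK bn0)//.
apply: ge0_ler_powR h; rewrite ?nnegrE ?powR_ge0//; first exact: ltW.
by rewrite addr_ge0// mulr_ge0.
Qed.

Lemma powR_le b x y : 0 < b -> 0 <= x -> x <= y -> x `^ b <= y `^ b.
Proof.
move=> b0 x0 xy; apply: ge0_ler_powR => //; first exact: ltW.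
by rewrite nnegrE (le_trans x0).
Qed.

Lemma powR_ler_root b x y : 0 < b -> 0 <= x -> 0 <= y ->
  (x `^ b <= y) = (x <= y `^ b^-1).
Proof.
move=> b0 x0 y0; have bn0 : b != 0 by rewrite gt_eqF.
apply/idP/idP => h.
  by rewrite -[x](powR_Kinv bn0)// powR_le// ?invr_gt0// powR_ge0.
by rewrite -[y](powR_invK bn0)// powR_le.
Qed.

Lemma powR_root_ler b x y : 0 < b -> 0 <= x -> 0 <= y ->
  (x <= y `^ b) = (x `^ b^-1 <= y).
Proof.
move=> b0 x0 y0; rewrite -{1}(invrK b) -powR_ler_root ?invr_gt0//.
Qed.

(** Young's inequality for [x^s] and [y^t] with the conjugate exponents [1/s] and [1/t]. *)
Lemma powR_amgm s t x y : 0 < s -> 0 < t -> s + t = 1 -> 0 <= x -> 0 <= y ->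
  x `^ s * y `^ t <= s * x + t * y.
Proof.
move=> s0 t0 st x0 y0.
have := @conjugate_powR R (x `^ s) (y `^ t) s^-1 t^-1.
rewrite !invrK !powR_Kinv ?gt_eqF// ![_ * s]mulrC ![_ * t]mulrC.
by apply=> //; rewrite ?powR_ge0// ?invr_gt0.
Qed.

Lemma continuous_powR b x : 0 < x -> {for x, continuous (fun y : R => y `^ b)}.
Proof.
move=> x0; apply: differentiable_continuous; apply/derivable1_diffP.
by apply: derivable_powR; rewrite in_itv/= x0.
Qed.

End Power.

(** * Affine interpolation *)

Section Chord.
Context {R : realType}.
Implicit Types (phi : R -> R) (r s x w : R).

(** Affine on all of [R]: it is also evaluated outside [[r, s]], where the maximum or minimum with
    an end value takes over. *)
Definition chord phi r s x := phi r + (phi s - phi r) / (s - r) * (x - r).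

Lemma chord_conv phi r s x y w :
  chord phi r s (w * x + (1 - w) * y) =
  w * chord phi r s x + (1 - w) * chord phi r s y.
Proof. by rewrite /chord; ring. Qed.

Lemma chord_le phi r s x y : r < s -> phi r <= phi s -> x <= y ->
  chord phi r s x <= chord phi r s y.
Proof.
move=> rs ph xy; rewrite lerD2l ler_wpM2l ?lerB//.
by rewrite divr_ge0// subr_ge0// ltW.
Qed.

Lemma chordl phi r s : chord phi r s r = phi r.
Proof. by rewrite /chord subrr mulr0 addr0. Qed.

Lemma chordr phi r s : r < s -> chord phi r s s = phi s.
Proof.
by move=> rs; rewrite /chord divfK ?subrKC// gt_eqF// subr_gt0.
Qed.

Lemma chord_itv phi r s w : r < s ->
  chord phi r s (w * r + (1 - w) * s) = w * phi r + (1 - w) * phi s.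
Proof. by move=> rs; rewrite chord_conv chordl chordr. Qed.

Lemma itv_conv r s x : r < s -> r <= x <= s ->
  exists2 w, 0 <= w <= 1 & x = w * r + (1 - w) * s.
Proof.
move=> rs /andP[rx xs]; have sr : 0 < s - r by rewrite subr_gt0.
exists ((s - x) / (s - r)); last by field; rewrite gt_eqF.
by rewrite divr_ge0 ?ler_pdivrMr//= ?mul1r ?lerB// ?subr_ge0// ltW.
Qed.

End Chord.

(** * The weighted geometric mean on the cone [W12] *)

Section Cone.
Context {R : realType}.
Variables s t p q : R.
Hypotheses (s0 : 0 < s) (t0 : 0 < t) (st1 : s + t = 1).
Hypotheses (p0 : 0 < p) (pq : p < q).
Implicit Types (x y a : R^o * R^o) (c k m w : R).

Definition geom x : R := x.1 `^ s * x.2 `^ t.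

(** The coordinates of [x] in the basis [(1, p)], [(1, q)], weighted by the values [p^t] and [q^t]
    of [geom] at these two vectors. *)
Definition secant x : R :=
  ((q * x.1 - x.2) * p `^ t + (x.2 - p * x.1) * q `^ t) / (q - p).

Let qp0 : 0 < q - p. Proof. by rewrite subr_gt0. Qed.
Let q0 : 0 < q. Proof. exact: lt_trans pq. Qed.
Let pt0 : 0 < p `^ t. Proof. exact: powR_gt0. Qed.
Let qt0 : 0 < q `^ t. Proof. exact: powR_gt0. Qed.

Lemma geom_ge0 x : 0 <= geom x.
Proof. by rewrite mulr_ge0// powR_ge0. Qed.

Lemma geomZ k x : 0 <= k -> nonneg_quadrant x -> geom (k *: x) = k * geom x.
Proof.
move=> k0 [x1 x2]; rewrite /geom/= !powRM//.
have kE : k `^ s * k `^ t = k by rewrite -powRD ?st1 ?oner_eq0// powRr1.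
by rewrite mulrACA kE.
Qed.

Lemma geom_gt0 x : nonneg_quadrant x -> 0 < geom x -> 0 < x.1 /\ 0 < x.2.
Proof.
move=> [x1 x2] g0; split; rewrite lt0r ?x1 ?x2 andbT.
  by apply: contraTneq g0 => x10; rewrite /geom x10 powR0 ?gt_eqF// mul0r ltxx.
by apply: contraTneq g0 => x20; rewrite /geom x20 powR0 ?gt_eqF// mulr0 ltxx.
Qed.

(** Divide each coordinate by that of [x + y] and apply AM-GM to the ratios. Adding the bounds for
    [x] and [y], the ratios sum to 1 in each coordinate, which leaves [s + t = 1]. *)
Lemma geom_superadd x y : nonneg_quadrant x -> nonneg_quadrant y ->
  geom x + geom y <= geom (x + y).
Proof.
move=> [x1 x2] [y1 y2].
have geom_eq0 (z : R^o * R^o) : (z.1 == 0) || (z.2 == 0) -> geom z = 0.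
  by case/orP => /eqP z0; rewrite /geom z0 powR0 ?gt_eqF// (mul0r, mulr0).
(* If a coordinate of [x + y] vanishes, it vanishes in [x] and in [y], and both values of [geom] are
   0. Otherwise the ratios below make sense. *)
have [u0|u0] := leP (x.1 + y.1) 0.
  have [x10 y10] : x.1 = 0 /\ y.1 = 0 by split; lra.
  by rewrite (geom_eq0 x) ?x10 ?eqxx// (geom_eq0 y) ?y10 ?eqxx// addr0 geom_ge0.
have [v0|v0] := leP (x.2 + y.2) 0.
  have [x20 y20] : x.2 = 0 /\ y.2 = 0 by split; lra.
  rewrite (geom_eq0 x) ?x20 ?eqxx ?orbT// (geom_eq0 y) ?y20 ?eqxx ?orbT//.
  by rewrite addr0 geom_ge0.
have bound z : nonneg_quadrant z -> geom z <= geom (x + y) *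
    (s * (z.1 / (x.1 + y.1)) + t * (z.2 / (x.2 + y.2))).
  move=> [z1 z2]; rewrite /geom/=.
  rewrite -{1}[z.1](divfK (lt0r_neq0 u0)) -{1}[z.2](divfK (lt0r_neq0 v0)).
  have [u0' v0'] := (ltW u0, ltW v0).
  rewrite (powRM _ (divr_ge0 z1 u0')) ?(powRM _ (divr_ge0 z2 v0'))//.
  rewrite mulrACA mulrC.
  by rewrite ler_wpM2l ?mulr_ge0 ?powR_ge0// powR_amgm// divr_ge0.
apply: le_trans (lerD (bound x _) (bound y _)) _ => //.
rewrite -mulrDr ler_piMr ?geom_ge0//.
suff -> : s * (x.1 / (x.1 + y.1)) + t * (x.2 / (x.2 + y.2)) +
  (s * (y.1 / (x.1 + y.1)) + t * (y.2 / (x.2 + y.2))) = s + t by rewrite st1.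
by field; rewrite !gt_eqF.
Qed.

Lemma nonneg_quadrantZ k x : 0 <= k -> nonneg_quadrant x ->
  nonneg_quadrant (k *: x).
Proof. by move=> k0 [x1 x2]; split; rewrite mulr_ge0. Qed.

Lemma geom_concave w x y : 0 <= w <= 1 ->
  nonneg_quadrant x -> nonneg_quadrant y ->
  w * geom x + (1 - w) * geom y <= geom (w *: x + (1 - w) *: y).
Proof.
move=> /andP[w0 w1] xq yq; have w'0 : 0 <= 1 - w by rewrite subr_ge0.
by rewrite -!geomZ// geom_superadd//; apply: nonneg_quadrantZ.
Qed.

Lemma W12_convex w x y : 0 <= w <= 1 ->
  W12 p q x -> W12 p q y -> W12 p q (w *: x + (1 - w) *: y).
Proof.
move=> /andP[w0 w1] [[x1 x2] /andP[px qx]] [[y1 y2] /andP[py qy]].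
have w'0 : 0 <= 1 - w by rewrite subr_ge0.
split; first by split; rewrite /= addr_ge0 ?mulr_ge0.
by rewrite /= !mulrDr !(mulrCA _ w) !(mulrCA _ (1 - w)) !lerD// ler_wpM2l.
Qed.

Lemma W12Z k x : 0 <= k -> W12 p q x -> W12 p q (k *: x).
Proof.
move=> k0 [xq /andP[px qx]]; split; first exact: nonneg_quadrantZ.
by rewrite /= !(mulrCA _ k) !ler_wpM2l.
Qed.

Lemma secant_conv w x y :
  secant (w *: x + (1 - w) *: y) = w * secant x + (1 - w) * secant y.
Proof. by rewrite /secant/= /GRing.scale/=; field; rewrite gt_eqF. Qed.

Lemma secantZ k x : secant (k *: x) = k * secant x.
Proof. by rewrite /secant/= /GRing.scale/=; field; rewrite gt_eqF. Qed.

Lemma secant_ge0 x : W12 p q x -> 0 <= secant x.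
Proof.
move=> [_ /andP[px qx]].
rewrite divr_ge0 ?(ltW qp0)// addr_ge0// mulr_ge0 ?subr_ge0//; exact: ltW.
Qed.

Definition ray r : R^o * R^o := (1, r).

Lemma geom_ray r : geom (ray r) = r `^ t.
Proof. by rewrite /geom powR1 mul1r. Qed.

Lemma W12_ray r : p <= r <= q -> W12 p q (ray r).
Proof.
move=> /andP[pr rq]; split; last by rewrite /= !mulr1 pr.
by split=> //=; rewrite (le_trans _ pr)// ltW.
Qed.

Lemma secant_ray_p : secant (ray p) = p `^ t.
Proof. by rewrite /secant/=; field; rewrite gt_eqF. Qed.

Lemma secant_ray_q : secant (ray q) = q `^ t.
Proof. by rewrite /secant/=; field; rewrite gt_eqF. Qed.

Lemma ray_decomp x : x = ((q * x.1 - x.2) / (q - p)) *: ray p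
  + ((x.2 - p * x.1) / (q - p)) *: ray q.
Proof.
by case: x => x1 x2; congr (_, _); rewrite /= /GRing.scale/=; field;
  rewrite gt_eqF.
Qed.

(** Write [x] as a nonnegative combination of the two bounding rays: superadditivity and homogeneity
    bound [geom x] below by the same combination of [p^t] and [q^t]. *)
Lemma secant_le_geom x : W12 p q x -> secant x <= geom x.
Proof.
move=> [xq /andP[px qx]].
have a0 : 0 <= (q * x.1 - x.2) / (q - p) by rewrite divr_ge0 ?subr_ge0// ltW.
have b0 : 0 <= (x.2 - p * x.1) / (q - p) by rewrite divr_ge0 ?subr_ge0// ltW.
have [pp _] : W12 p q (ray p) by apply: W12_ray; rewrite lexx ltW.
have [qq _] : W12 p q (ray q) by apply: W12_ray; rewrite lexx ltW.
rewrite {2}[x]ray_decomp.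
apply: le_trans _ (geom_superadd (nonneg_quadrantZ a0 pp)
  (nonneg_quadrantZ b0 qq)).
rewrite !geomZ// !geom_ray /secant mulrDl.
by rewrite lerD// mulrAC.
Qed.

(** Intermediate value theorem along the segment from [x] to [a]; positive coordinates keep the
    segment where the powers are continuous. *)
Lemma segment_level a x c : 0 < a.1 -> 0 < a.2 -> 0 < x.1 -> 0 < x.2 ->
  geom a <= c <= geom x ->
  exists2 m, 0 <= m <= 1 & geom (m *: a + (1 - m) *: x) = c.
Proof.
move=> a1 a2 x1 x2 ac.
pose g m : R := geom (m *: a + (1 - m) *: x).
have pos (u v m : R) : 0 < u -> 0 < v -> 0 <= m <= 1 -> 0 < m * u + (1 - m) * v.
  move=> u0 v0 /andP[m0 m1]; have [->|mn0] := eqVneq m 0.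
    by rewrite mul0r add0r subr0 mul1r.
  apply: ltr_wpDr; first by rewrite mulr_ge0 ?subr_ge0 ?(ltW v0).
  by rewrite mulr_gt0// lt0r mn0.
have cont (u v b m : R) : 0 < u -> 0 < v -> 0 <= m <= 1 ->
    {for m, continuous (fun m : R => (m * u + (1 - m) * v) `^ b)}.
  move=> u0 v0 m01.
  apply: (@continuous_comp _ _ _ (fun m : R => m * u + (1 - m) * v)
    (fun y : R => y `^ b)); last by apply: continuous_powR; exact: pos.
  apply: cvgD; apply: cvgMl; first exact: cvg_id.
  by apply: cvgB; [exact: cvg_cst|exact: cvg_id].
have [||m] := @IVT R g 0 1 c ler01.
- apply: continuous_in_subspaceT => m /set_mem/=; rewrite in_itv/= => m01.
  by apply: cvgM; exact: cont.
- rewrite /g scale0r add0r subr0 scale1r scale1r subrr scale0r addr0.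
  by rewrite ge_min le_max; case/andP: ac => -> ->; rewrite !orbT.
by rewrite in_itv/= => m01 gm; exists m.
Qed.


Lemma secant_gt0 x : W12 p q x -> 0 < x.1 -> 0 < secant x.
Proof.
move=> [_ /andP[px qx]] x1; apply: divr_gt0 => //.
have pqt : p `^ t <= q `^ t by apply: powR_le; rewrite // ltW.
(* Lowering [q^t] to [p^t] collapses the numerator to [(q - p) x1 p^t]. *)
apply: (@lt_le_trans _ _ ((q * x.1 - x.2) * p `^ t + (x.2 - p * x.1) * p `^ t)).
  rewrite -mulrDl mulr_gt0//.
  by rewrite addrA subrK -mulrBl mulr_gt0.
by rewrite lerD2l ler_wpM2l// subr_ge0.
Qed.

(** The points [a] and [b] are where the line through [x] with constant [secant] meets the two
    bounding rays, on which [geom] and [secant] agree. *)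
Lemma secant_ends x : W12 p q x -> 0 < secant x ->
  exists w a b, [/\ 0 <= w <= 1, W12 p q a /\ W12 p q b,
    geom a = secant x /\ secant a = secant x,
    geom b = secant x /\ secant b = secant x & x = w *: a + (1 - w) *: b].
Proof.
move=> [xq /andP[px qx]] h0.
have hP0 : 0 <= secant x / p `^ t by rewrite divr_ge0 ?(ltW h0) ?powR_ge0.
have hQ0 : 0 <= secant x / q `^ t by rewrite divr_ge0 ?(ltW h0) ?powR_ge0.
have pW : W12 p q (ray p) by apply: W12_ray; rewrite lexx ltW.
have qW : W12 p q (ray q) by apply: W12_ray; rewrite lexx ltW.
have a0 : 0 <= (q * x.1 - x.2) * p `^ t by rewrite mulr_ge0 ?subr_ge0 ?powR_ge0.
have b0 : 0 <= (x.2 - p * x.1) * q `^ t by rewrite mulr_ge0 ?subr_ge0 ?powR_ge0.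
have ab0 : 0 < (q * x.1 - x.2) * p `^ t + (x.2 - p * x.1) * q `^ t.
  by move: h0; rewrite /secant pmulr_lgt0 ?invr_gt0.
(* The weight of [a] is the share that the ray of slope [p] contributes to [secant x]. *)
exists ((q * x.1 - x.2) * p `^ t / (secant x * (q - p))).
exists ((secant x / p `^ t) *: ray p), ((secant x / q `^ t) *: ray q).
split.
- rewrite /secant divfK ?gt_eqF// divr_ge0 ?(ltW ab0)//=.
  by rewrite ler_pdivrMr// mul1r lerDl.
- by split; apply: W12Z.
- rewrite geomZ//; last by case: pW.
  by rewrite secantZ geom_ray secant_ray_p divfK ?gt_eqF.
- rewrite geomZ//; last by case: qW.
  by rewrite secantZ geom_ray secant_ray_q divfK ?gt_eqF.
- rewrite /secant; case: x {px qx xq h0 hP0 hQ0 a0 b0} ab0 => x1 x2 /= ab0.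
  by congr (_, _); rewrite /= /GRing.scale/=; field; rewrite !gt_eqF.
Qed.

(* On the line through [x] where [secant] is constant, [geom] equals
   [secant x] at both ends of [W12 p q] and exceeds [c] at [x], so it takes
   the value [c] on both sides of [x]. *)
Lemma level_hull x c : W12 p q x -> 0 < c -> secant x <= c <= geom x ->
  exists w a b, [/\ 0 <= w <= 1, W12 p q a /\ W12 p q b,
    geom a = c, geom b = c & x = w *: a + (1 - w) *: b].
Proof.
move=> xW c0 /andP[hc]; rewrite le_eqVlt => /predU1P[cg|cg].
  exists 1, x, x; split => //; first by rewrite ler01 lexx.
  by rewrite subrr scale0r scale1r addr0.
have [x1 x2] : 0 < x.1 /\ 0 < x.2.
  by apply: geom_gt0; [case: xW|exact: lt_trans cg].
have h0 := secant_gt0 xW x1.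
have [w [a [b [w01 [aW bW] [ga _] [gb _] xE]]]] := secant_ends xW h0.
have [a1 a2] : 0 < a.1 /\ 0 < a.2 by apply: geom_gt0; [case: aW|rewrite ga].
have [b1 b2] : 0 < b.1 /\ 0 < b.2 by apply: geom_gt0; [case: bW|rewrite gb].
have [|m m01 gm] := segment_level a1 a2 x1 x2 (c := c).
  by rewrite ga hc ltW.
have [|n n01 gn] := segment_level b1 b2 x1 x2 (c := c).
  by rewrite gb hc ltW.
have neq0 k (y : R^o * R^o) : 0 <= k <= 1 ->
    geom (k *: y + (1 - k) *: x) = c -> 0 < k.
  move=> /andP[k0 _] gk; rewrite lt0r k0 andbT.
  apply: contraTneq cg => k0'; move: gk.
  by rewrite k0' scale0r add0r subr0 scale1r => ->; rewrite ltxx.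
have [m0 n0] := (neq0 _ _ m01 gm, neq0 _ _ n01 gn).
have /andP[w0 w1] := w01.
have D0 : 0 < w * n + (1 - w) * m.
  have [->|wn0] := eqVneq w 0; first by rewrite mul0r add0r subr0 mul1r.
  apply: ltr_wpDr; first by rewrite mulr_ge0 ?subr_ge0// ltW.
  by rewrite mulr_gt0// lt0r wn0.
(* The new ends are displaced from [x] by [m (a - x)] and [n (b - x)]. Since
   [w (a - x) + (1 - w) (b - x) = 0], weights proportional to [w n] and [(1 - w) m] make these
   displacements cancel. *)
exists (w * n / (w * n + (1 - w) * m)).
exists (m *: a + (1 - m) *: x), (n *: b + (1 - n) *: x); split => //.
- rewrite divr_ge0 ?(ltW D0) ?mulr_ge0 ?(ltW n0)//= ler_pdivrMr// mul1r lerDl.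
  by rewrite mulr_ge0 ?subr_ge0// ltW.
- by split; apply: W12_convex.
- have [e1 e2] : x.1 = w * a.1 + (1 - w) * b.1 /\ x.2 = w * a.2 + (1 - w) * b.2.
    by rewrite xE.
  case: x {xW cg x1 x2 h0 ga gb xE gm gn neq0 hc} e1 e2 => x1 x2 /= e1 e2.
  congr (_, _); rewrite /= /GRing.scale/= ?e1 ?e2; field; exact: lt0r_neq0.
Qed.

(** * The hull of the graph of [phi] composed with [geom] *)

Section Envelope.
Variables (phi : R -> R) (l u : R).
Hypotheses (l0 : 0 < l) (lu : l < u).

(** Here [l] and [u] are levels of [geom]; for the theorem they become the [beta]-th roots of its
    bounds, with [phi r = r^beta]. *)
Definition graph_on : set (R^o * R^o * R^o) :=
  [set xz | [/\ W12 p q xz.1, l <= geom xz.1 <= u & xz.2 = phi (geom xz.1)]].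

Section Membership.
Variable C : set (R^o * R^o * R^o).
Hypotheses (cC : convex_set C) (FC : graph_on `<=` C).

Lemma mem_conv w x y (z1 z2 : R) : 0 <= w <= 1 ->
  C (x, z1 : R^o) -> C (y, z2 : R^o) ->
  C (w *: x + (1 - w) *: y, (w * z1 + (1 - w) * z2 : R^o)).
Proof. by move=> w01 Cx Cy; have := (convex_setP C).1 cC w _ _ w01 Cx Cy. Qed.

Lemma mem_level x c : W12 p q x -> l <= c <= u -> secant x <= c <= geom x ->
  C (x, phi c : R^o).
Proof.
move=> xW lcu hcg; have c0 : 0 < c by case/andP: lcu => /(lt_le_trans l0).
have [w [a [b [w01 [aW bW] ga gb ->]]]] := level_hull xW c0 hcg.
have -> : phi c = w * phi c + (1 - w) * phi c by ring.
by apply: mem_conv => //; apply: FC; split=> //=; rewrite ?ga ?gb.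
Qed.

(** Along the ray through [x], [geom] is linear. Hence [x] divides the segment between its multiples
    at levels [l] and [u] as [geom x] divides [[l, u]], and the heights interpolate to the chord. *)
Lemma mem_ray x : W12 p q x -> l <= geom x <= u ->
  C (x, chord phi l u (geom x) : R^o).
Proof.
move=> xW lgu; have g0 : 0 < geom x by case/andP: lgu => /(lt_le_trans l0).
have [w w01 gE] := itv_conv lu lgu.
rewrite gE chord_itv//.
have xE : x = w *: ((l / geom x) *: x) + (1 - w) *: ((u / geom x) *: x).
  rewrite !scalerA -scalerDl !mulrA -mulrDl -gE divff ?scale1r//.
  exact: lt0r_neq0.
rewrite {1}xE.
have mem r : l <= r <= u -> C ((r / geom x) *: x, phi r : R^o).
  move=> lru; have r0 : 0 < r by case/andP: lru => /(lt_le_trans l0).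
  have gr : geom ((r / geom x) *: x) = r.
    rewrite geomZ ?divfK ?gt_eqF//; last by case: xW.
    by rewrite divr_ge0 ?geom_ge0// ltW.
  apply: FC; split=> /=; rewrite ?gr//.
  by apply: W12Z => //; rewrite divr_ge0 ?geom_ge0// ltW.
by apply: mem_conv => //; apply: mem; rewrite lexx ltW.
Qed.

(** At the two ends on the bounding rays [geom] equals [secant x], so [mem_ray] gives both the same
    chord height, which passes to [x]. *)
Lemma mem_secant x : W12 p q x -> l <= secant x <= u ->
  C (x, chord phi l u (secant x) : R^o).
Proof.
move=> xW lhu; have h0 : 0 < secant x by case/andP: lhu => /(lt_le_trans l0).
have [w [a [b [w01 [aW bW] [ga _] [gb _] xE]]]] := secant_ends xW h0.
rewrite {1}xE.
have -> : chord phi l u (secant x) =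
  w * chord phi l u (secant x) + (1 - w) * chord phi l u (secant x) by ring.
by apply: mem_conv => //; [rewrite -ga|rewrite -gb]; apply: mem_ray => //;
  rewrite ?ga ?gb.
Qed.

Lemma mem_between x (z1 z2 z : R) : z1 <= z <= z2 ->
  C (x, z1 : R^o) -> C (x, z2 : R^o) -> C (x, z : R^o).
Proof.
move=> /andP[z1z zz2] C1 C2.
have [z12|z21] := ltP z1 z2; last first.
  suff -> : z = z1 by [].
  by apply/eqP; rewrite eq_le z1z (le_trans zz2).
have [|w w01 ->] := @itv_conv R z1 z2 z z12; first by rewrite z1z.
have -> : x = w *: x + (1 - w) *: x by rewrite -scalerDl subrKC scale1r.
exact: mem_conv.
Qed.

End Membership.

Hypothesis phi_le : forall x y : R, 0 <= x -> x <= y -> phi x <= phi y.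

(** The lower bound is convex, being [phi] after a linear map; the upper one is concave, because the
    chord is affine and nondecreasing and [geom] is concave. *)
Lemma conv_hull_graph_convex :
  (forall w x y : R, 0 <= w <= 1 -> 0 <= x -> 0 <= y ->
    phi (w * x + (1 - w) * y) <= w * phi x + (1 - w) * phi y) ->
  conv_hull graph_on = [set xz | [/\ W12 p q xz.1, l <= geom xz.1,
    secant xz.1 <= u & Num.max (phi l) (phi (secant xz.1)) <= xz.2 <=
      Num.min (phi u) (chord phi l u (geom xz.1))]].
Proof.
move=> phi_conv; apply: conv_hull_eq.
- apply/convex_setP => w [x z] [y v] /= w01 [xW lx xu zB] [yW ly yu vB].
  have /andP[w0 w1] := w01; have w'0 : 0 <= 1 - w by rewrite subr_ge0.
  have gc : w * geom x + (1 - w) * geom y <= geom (w *: x + (1 - w) *: y).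
    by apply: geom_concave => //; [case: xW|case: yW].
  have wc (c : R) : c = w * c + (1 - w) * c by ring.
  have wle (c1 c2 c3 c4 : R) : c1 <= c2 -> c3 <= c4 ->
      w * c1 + (1 - w) * c3 <= w * c2 + (1 - w) * c4.
    by move=> c12 c34; rewrite lerD// ler_wpM2l.
  move: zB vB; rewrite !ge_max !le_min => /andP[/andP[z1 z2] /andP[z3 z4]].
  move=> /andP[/andP[v1 v2] /andP[v3 v4]]; split.
  + exact: W12_convex.
  + by apply: le_trans gc; rewrite [leLHS]wc wle.
  + by rewrite secant_conv [leRHS]wc wle.
  + rewrite secant_conv; do 2 (apply/andP; split).
    * by rewrite [leLHS]wc; exact: wle.
    * apply: le_trans (wle _ _ _ _ z2 v2).
      by apply: phi_conv => //; exact: secant_ge0.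
    * by rewrite [leRHS]wc; exact: wle.
    * apply: le_trans (wle _ _ _ _ z4 v4) _; rewrite -chord_conv.
      by apply: chord_le => //; apply: phi_le; exact: ltW.
- move=> [x z] [/= xW /andP[lg gu] ->]; have hg := secant_le_geom xW.
  split => //=; first exact: le_trans hg gu.
  rewrite ge_max le_min !phi_le ?geom_ge0 ?secant_ge0// ?(ltW l0)//=.
  have [|w w01 ->] := @itv_conv R l u (geom x) lu; first by rewrite lg.
  by rewrite chord_itv// phi_conv// ltW// (lt_trans l0).
- move=> C cC FC [x z] [/= xW lg hu zB].
  apply: (mem_between cC zB).
  (* The lowest point is at level [max(l, secant x)], which lies between [secant x] and [geom x]. *)
  + have [hl|lh] := leP (secant x) l.
      rewrite max_l; last by apply: phi_le => //; exact: secant_ge0.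
      by apply: (mem_level cC FC) => //; rewrite ?lexx ?hl// ltW.
    rewrite max_r; last by apply: phi_le; exact: ltW.
    apply: (mem_level cC FC) => //; first by rewrite (ltW lh).
    by rewrite lexx secant_le_geom.
  (* The highest point is the chord over the ray through [x] while [geom x <= u]; beyond that, level
     [u] lies between [secant x] and [geom x]. *)
  + have [gu|ug] := leP (geom x) u.
      rewrite min_r; first by apply: (mem_ray cC FC) => //; rewrite lg.
      rewrite -(chordr phi lu) chord_le// phi_le// ltW//.
    rewrite min_l; last first.
      rewrite -{1}(chordr phi lu) chord_le// ?phi_le// ltW//.
    apply: (mem_level cC FC) => //; first by rewrite lexx ltW.
    by rewrite hu ltW.
Qed.

(** The roles are exchanged: the chord now acts on the linear [secant] below, and [phi] on [geom]
    above, concave because [phi] is concave and nondecreasing on the nonnegative reals. *)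
Lemma conv_hull_graph_concave :
  (forall w x y : R, 0 <= w <= 1 -> 0 <= x -> 0 <= y ->
    w * phi x + (1 - w) * phi y <= phi (w * x + (1 - w) * y)) ->
  conv_hull graph_on = [set xz | [/\ W12 p q xz.1, l <= geom xz.1,
    secant xz.1 <= u & Num.max (phi l) (chord phi l u (secant xz.1)) <= xz.2
      <= Num.min (phi u) (phi (geom xz.1))]].
Proof.
move=> phi_conc; have philu : phi l <= phi u by apply: phi_le; exact: ltW.
apply: conv_hull_eq.
- apply/convex_setP => w [x z] [y v] /= w01 [xW lx xu zB] [yW ly yu vB].
  have /andP[w0 w1] := w01; have w'0 : 0 <= 1 - w by rewrite subr_ge0.
  have gc : w * geom x + (1 - w) * geom y <= geom (w *: x + (1 - w) *: y).
    by apply: geom_concave => //; [case: xW|case: yW].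
  have wc (c : R) : c = w * c + (1 - w) * c by ring.
  have wle (c1 c2 c3 c4 : R) : c1 <= c2 -> c3 <= c4 ->
      w * c1 + (1 - w) * c3 <= w * c2 + (1 - w) * c4.
    by move=> c12 c34; rewrite lerD// ler_wpM2l.
  move: zB vB; rewrite !ge_max !le_min => /andP[/andP[z1 z2] /andP[z3 z4]].
  move=> /andP[/andP[v1 v2] /andP[v3 v4]]; split.
  + exact: W12_convex.
  + by apply: le_trans gc; rewrite [leLHS]wc wle.
  + by rewrite secant_conv [leRHS]wc wle.
  + rewrite secant_conv chord_conv; do 2 (apply/andP; split).
    * by rewrite [leLHS]wc; exact: wle.
    * exact: wle.
    * by rewrite [leRHS]wc; exact: wle.
    * apply: le_trans (wle _ _ _ _ z4 v4) _.
      apply: le_trans (phi_conc _ _ _ _ _ _) (phi_le _ gc);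
        by rewrite ?geom_ge0// addr_ge0// mulr_ge0// geom_ge0.
- move=> [x z] [/= xW /andP[lg gu] ->]; have hg := secant_le_geom xW.
  split => //=; first exact: le_trans hg gu.
  rewrite ge_max le_min lexx !phi_le ?geom_ge0 ?(ltW l0)//= andbT.
  (* Monotonicity moves the chord from [secant x] up to [geom x], where it lies below [phi] by
     concavity. *)
  apply: le_trans (chord_le lu philu hg) _.
  have [|w w01 ->] := @itv_conv R l u (geom x) lu; first by rewrite lg.
  by rewrite chord_itv// phi_conc// ltW// (lt_trans l0).
- move=> C cC FC [x z] [/= xW lg hu zB].
  apply: (mem_between cC zB).
  + have [hl|lh] := leP (secant x) l.
      rewrite max_l; last by rewrite -(chordl phi l u) chord_le.
      by apply: (mem_level cC FC) => //; rewrite ?lexx ?hl// ltW.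
    rewrite max_r; last by rewrite -(chordl phi l u) chord_le// ltW.
    by apply: (mem_secant cC FC) => //; rewrite (ltW lh).
  + have [gu|ug] := leP (geom x) u.
      rewrite min_r; last by apply: phi_le => //; exact: geom_ge0.
      apply: (mem_level cC FC) => //; first by rewrite lg.
      by rewrite lexx secant_le_geom.
    rewrite min_l; last by apply: phi_le; rewrite ltW// (lt_trans l0).
    apply: (mem_level cC FC) => //; first by rewrite lexx ltW.
    by rewrite hu ltW.
Qed.

End Envelope.

End Cone.

(** * Matching the explicit constants with [geom], [secant] and [chord] *)

Section Constants.
Context {R : realType}.
Variables a1 a2 p q l u : R.
Hypotheses (a1_gt0 : 0 < a1) (a2_gt0 : 0 < a2).
Hypotheses (p_gt0 : 0 < p) (pq : p < q) (l_gt0 : 0 < l) (lu : l < u).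

Let beta := a1 + a2.
Let s := a1 / beta.
Let t := a2 / beta.
(** The factor from [d2 x1 - d1 x2] to [secant], and the [beta]-th root of [lambda]. *)
Let c := p `^ t * q `^ t / (q - p).
Implicit Types x : R^o * R^o.

Let beta_gt0 : 0 < beta. Proof. exact: addr_gt0. Qed.
Let beta_neq0 : beta != 0. Proof. exact: lt0r_neq0. Qed.
Let q_gt0 : 0 < q. Proof. exact: lt_trans pq. Qed.
Let qp_gt0 : 0 < q - p. Proof. by rewrite subr_gt0. Qed.
Let u_gt0 : 0 < u. Proof. exact: lt_trans lu. Qed.
Let pt_gt0 : 0 < p `^ t. Proof. exact: powR_gt0. Qed.
Let qt_gt0 : 0 < q `^ t. Proof. exact: powR_gt0. Qed.
Let c_gt0 : 0 < c. Proof. by rewrite divr_gt0// mulr_gt0. Qed.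

Lemma weights_sum : s + t = 1.
Proof. by rewrite /s /t -mulrDl divff. Qed.

(** Removes the exponent [s], so that identities between the constants become rational in [p], [q],
    [p^t], [q^t]. *)
Lemma powR_complement r : 0 < r -> r `^ s = r / r `^ t.
Proof.
move=> r0; rewrite -{2}(powRr1 (ltW r0)) -powRB; last first.
  by rewrite (lt0r_neq0 r0) implybT.
by rewrite -weights_sum addrK.
Qed.

Lemma d1E : d1 a1 a2 p q = (q `^ t)^-1 - (p `^ t)^-1.
Proof. by rewrite /d1 -/beta mulNr !powRN. Qed.

Lemma d2E : d2 a1 a2 p q = q / q `^ t - p / p `^ t.
Proof. by rewrite /d2 -/beta -/s !powR_complement. Qed.

Lemma lambdaE : lambda a1 a2 p q = c `^ beta.
Proof.
have -> : c = p `^ t / ((q - p) / q `^ t).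
  by rewrite /c; field; rewrite !gt_eqF.
have D0 : 0 < (q - p) / q `^ t by rewrite divr_gt0.
rewrite /lambda -/beta.
have -> : d2 a1 a2 p q - d1 a1 a2 p q * p = (q - p) / q `^ t.
  by rewrite d1E d2E; field; rewrite !gt_eqF.
have -> : p `^ a2 = (p `^ t) `^ beta by rewrite -powRrM /t divfK.
apply: (canLR (mulfK _)); first by rewrite gt_eqF// powR_gt0.
by rewrite -powRM ?divfK ?gt_eqF// ?divr_ge0// ltW.
Qed.

Lemma secantE x :
  secant t p q x = c * (d2 a1 a2 p q * x.1 - d1 a1 a2 p q * x.2).
Proof. by rewrite d1E d2E /secant /c; field; rewrite !gt_eqF. Qed.

Lemma fE x : nonneg_quadrant x -> f a1 a2 x = geom s t x `^ beta.
Proof.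
by move=> [x1 x2]; rewrite /geom powRM ?powR_ge0// -!powRrM /s /t !divfK.
Qed.

Lemma d_ge0 x : W12 p q x -> 0 <= d2 a1 a2 p q * x.1 - d1 a1 a2 p q * x.2.
Proof.
by move=> /(secant_ge0 t p_gt0 pq); rewrite secantE pmulr_rge0.
Qed.

Let L := l `^ beta^-1.
Let U := u `^ beta^-1.
Let LU : L < U.
Proof. by apply: gt0_ltr_powR; rewrite ?nnegrE ?invr_gt0// ltW. Qed.
Let LE : L `^ beta = l. Proof. by rewrite powR_invK// ltW. Qed.
Let UE : U `^ beta = u. Proof. by rewrite powR_invK// ltW. Qed.

Lemma F_graph :
  F a1 a2 l u (W12 p q) = graph_on s t p q (fun r : R => r `^ beta) L U.
Proof.
have geomLU x : nonneg_quadrant x ->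
    (l <= f a1 a2 x <= u) = (L <= geom s t x <= U).
  move=> xq; rewrite fE// powR_root_ler ?geom_ge0 ?(ltW l_gt0)//.
  by rewrite (powR_ler_root (x := geom s t x)) ?geom_ge0 ?(ltW u_gt0).
apply/seteqP; split=> -[x z] /=.
  move=> [[[/= xq lfu] xW] /= ->].
  by split; [exact: xW|rewrite -geomLU|rewrite fE].
move=> [/= xW lgu ->]; have xq := xW.1.
by split; [split=> //; split; rewrite //= geomLU|rewrite /= fE].
Qed.

Lemma Y_iff x : Y a1 a2 p q l u x <->
  [/\ W12 p q x, L <= geom s t x & secant t p q x <= U].
Proof.
have Uc0 : 0 <= U / c by rewrite divr_ge0 ?powR_ge0// (ltW c_gt0).
have uE : (u / lambda a1 a2 p q) `^ beta^-1 = U / c.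
  rewrite lambdaE; have -> : u / c `^ beta = (U / c) `^ beta.
    apply: (canLR (mulfK _)); first by rewrite gt_eqF// powR_gt0.
    by rewrite -powRM ?(ltW c_gt0)// divfK ?UE// gt_eqF.
  by rewrite powR_Kinv.
have lE (xq : nonneg_quadrant x) :
    (l <= x.1 `^ a1 * x.2 `^ a2) = (L <= geom s t x).
  by rewrite -[_ * _]/(f a1 a2 x) fE// powR_root_ler ?geom_ge0 ?(ltW l_gt0).
have hE : (d2 a1 a2 p q * x.1 - d1 a1 a2 p q * x.2
    <= (u / lambda a1 a2 p q) `^ beta^-1) = (secant t p q x <= U).
  by rewrite uE ler_pdivlMr// mulrC secantE.
split=> [[xq xW lf hu]|[[xq xW] lg hU]].
  by split; [split| rewrite -lE | rewrite -hE].
by split; rewrite // ?lE ?hE.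
Qed.

(** Identifies [z0] as the intercept of the chord of [r^beta] over [[L, U]]. *)
Lemma chord_powR r : chord (fun r : R => r `^ beta) L U r =
  z0 beta l u + (u - l) / (U - L) * r.
Proof.
rewrite /chord LE UE /z0 -/L -/U; field.
by rewrite gt_eqF// subr_gt0.
Qed.

Lemma lambda_secant x : W12 p q x ->
  lambda a1 a2 p q * (d2 a1 a2 p q * x.1 - d1 a1 a2 p q * x.2) `^ beta
  = secant t p q x `^ beta.
Proof.
by move=> xW; rewrite lambdaE -powRM ?d_ge0 ?(ltW c_gt0)// secantE.
Qed.

Lemma zeta_secant x :
  zeta a1 a2 p q l u * (d2 a1 a2 p q * x.1 - d1 a1 a2 p q * x.2) + z0 beta l u
  = chord (fun r : R => r `^ beta) L U (secant t p q x).
Proof.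
rewrite chord_powR /zeta -/beta -/L -/U lambdaE powR_Kinv ?(ltW c_gt0)//.
by rewrite secantE; ring.
Qed.

(** [gamma] is the [beta]-th power of the chord's slope, so the root returns slope times
    [geom x]. *)
Lemma gamma_geom x : nonneg_quadrant x ->
  z0 beta l u + (gamma beta l u * x.1 `^ a1 * x.2 `^ a2) `^ beta^-1
  = chord (fun r : R => r `^ beta) L U (geom s t x).
Proof.
move=> xq; rewrite chord_powR -mulrA -[X in _ * X]/(f a1 a2 x) fE//.
have k0 : 0 <= (u - l) / (U - L) by rewrite divr_ge0// subr_ge0 ltW.
by rewrite /gamma -/L -/U -powRM ?geom_ge0// powR_Kinv// mulr_ge0 ?geom_ge0.
Qed.

End Constants.

(** * The two regimes: [r^beta] convex for [beta >= 1], concave for [beta <= 1] *)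

Theorem corollary1 (R : realType) (a1 a2 p q l u : R)
    (ha1 : 0 < a1) (ha2 : 0 < a2)
    (hp : 0 < p) (hpq : p < q) (hl : 0 < l) (hlu : l < u) :
  let beta := a1 + a2 in
  let D1 := d1 a1 a2 p q in
  let D2 := d2 a1 a2 p q in
  (1 <= beta ->
    conv_hull (F a1 a2 l u (W12 p q)) =
    [set xz : R^o * R^o * R^o |
      let: (x, z) := xz in
      Y a1 a2 p q l u x /\
      Num.max l (lambda a1 a2 p q * (D2 * x.1 - D1 * x.2) `^ beta) <= z
        <= Num.min u (z0 beta l u +
             (gamma beta l u * x.1 `^ a1 * x.2 `^ a2) `^ beta^-1)])
  /\
  (beta <= 1 ->
    conv_hull (F a1 a2 l u (W12 p q)) =
    [set xz : R^o * R^o * R^o |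
      let: (x, z) := xz in
      Y a1 a2 p q l u x /\
      Num.max l (zeta a1 a2 p q l u * (D2 * x.1 - D1 * x.2) + z0 beta l u) <= z
        <= Num.min u (x.1 `^ a1 * x.2 `^ a2)]).
Proof.
move=> beta D1 D2; have beta0 : 0 < beta := addr_gt0 ha1 ha2.
pose s := a1 / beta; pose t := a2 / beta.
have [s0 t0] : 0 < s /\ 0 < t by rewrite !divr_gt0.
have st : s + t = 1 := weights_sum ha1 ha2.
have L0 : 0 < l `^ beta^-1 by apply: powR_gt0.
have u0 : 0 < u := lt_trans hl hlu.
have LU : l `^ beta^-1 < u `^ beta^-1.
  by apply: gt0_ltr_powR; rewrite ?nnegrE ?invr_gt0// ltW.
have phi_le (x y : R) : 0 <= x -> x <= y -> x `^ beta <= y `^ beta.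
  exact: powR_le.
have [bn0 [l0' u0']] : beta != 0 /\ 0 <= l /\ 0 <= u.
  by rewrite gt_eqF// !ltW.
split=> beta1; rewrite (F_graph p q ha1 ha2 hl hlu).
  rewrite (conv_hull_graph_convex s0 t0 st hp hpq L0 LU phi_le); last first.
    by move=> w x y; exact: powR_convex.
  (* [powR_invK] turns the end heights, [beta]-th powers of [beta]-th roots, back into [l] and
     [u]. *)
  apply/seteqP; split=> -[x z] /=; rewrite !powR_invK//.
    move=> [xW Lg hU zB]; have xq := xW.1; split; first exact/Y_iff.
    by rewrite lambda_secant// gamma_geom.
  move=> [/(Y_iff ha1 ha2 hp hpq hl hlu)[xW Lg hU]]; have xq := xW.1.
  by rewrite lambda_secant// gamma_geom.
rewrite (conv_hull_graph_concave s0 t0 st hp hpq L0 LU phi_le); last first.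
  by move=> w x y; exact: powR_concave.
apply/seteqP; split=> -[x z] /=; rewrite !powR_invK//.
  move=> [xW Lg hU zB]; have xq := xW.1; split; first exact/Y_iff.
  by rewrite zeta_secant// -[x.1 `^ a1 * _]/(f a1 a2 x) fE.
move=> [/(Y_iff ha1 ha2 hp hpq hl hlu)[xW Lg hU]]; have xq := xW.1.
by rewrite zeta_secant// -[x.1 `^ a1 * _]/(f a1 a2 x) fE.
Qed.
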